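(* Let $G$ be a finite, simple, undirected graph that is a bilaterally-complete tripartite graph; that is, $G=(A,B,C;E)$ is tripartite with vertex set partitioned into three independent sets $A$, $B$, $C$, and at least two of the three induced bipartite subgraphs $G[A\cup B]$, $G[A\cup C]$, $G[B\cup C]$ are complete bipartite graphs (with respect to the indicated parts). Then $\tau_{\triangle}(G)=\nu_{\triangle}(G)$, where $\tau_{\triangle}(G)$ is the minimum number of edges of $G$ meeting all triangles of $G$, and $\nu_{\triangle}(G)$ is the maximum number of pairwise edge-disjoint triangles in $G$.
   Context: All graphs are finite, simple and undirected. A triangle in a graph $G=(V,E)$ is a subgraph isomorphic to $K_3$ (three vertices all joined by edges). Let $\mathcal{T}$ denote the set of all triangles in $G$. A subset $E'\subseteq E$ is a $\mathcal{T}$-transversal if every triangle in $\mathcal{T}$ has an edge in $E'$. A subset $\mathcal{T}'\subseteq\mathcal{T}$ is a packing in $G$ if the triangles in $\mathcal{T}'$ are pairwise edge-disjoint. $\tau_{\triangle}(G)$ denotes the cardinality of a smallest $\mathcal{T}$-transversal in $G$, and $\nu_{\triangle}(G)$ denotes the cardinality of a largest packing in $G$. A tripartite graph $G=(A,B,C;E)$ is a graph whose vertex set is partitioned as $V=A\cup B\cup C$ with no edge having both endpoints in the same part. For $X\subseteq V$, $G[X]$ denotes the subgraph of $G$ induced by $X$. The sides of $G$ are the induced bipartite subgraphs $G[A\cup B]$, $G[A\cup C]$ and $G[B\cup C]$. A side, say $G[A\cup B]$, is complete bipartite if every vertex of $A$ is adjacent to every vertex of $B$. $G$ is called bilaterally-complete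 if at least two of its sides are complete bipartite graphs. *)

(* Defs.v *)
From mathcomp Require Import all_boot.

Set Implicit Arguments.
Unset Strict Implicit.
Unset Printing Implicit Defensive.

(* A finite simple graph is given by a symmetric and irreflexive adjacency
   relation e on a finType T; its vertex set is all of T. *)
Definition simple_graph (T : finType) (e : rel T) : Prop :=
  symmetric e /\ irreflexive e.

Section Triangles.

Variables (T : finType) (e : rel T).
Implicit Types (x y z : T) (t f : {set T}) (S P : {set {set T}}).

(* Undirected edges are unordered pairs. *)
Definition edges : {set {set T}} :=
  [set [set p.1; p.2] | p : T * T & e p.1 p.2].

(* A subgraph isomorphic to K_3 is determined by its set of vertices. *)
Definition triangles : {set {set T}} :=
  [set t : {set T} | (#|t| == 3) &&
    [forall x in t, forall y in t, (x != y) ==> e x y]].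

Definition edges_of t : {set {set T}} := [set f in edges | f \subset t].

Definition transversal S : bool :=
  (S \subset edges) &&
  [forall t in triangles, exists f in edges_of t, f \in S].

Definition packing P : bool :=
  (P \subset triangles) &&
  [forall t1 in P, forall t2 in P,
     (t1 != t2) ==> [disjoint edges_of t1 & edges_of t2]].

Lemma transversal_edges : transversal edges.
Proof.
rewrite /transversal subxx /=; apply/'forall_implyP=> t.
rewrite inE => /andP[t3 /'forall_implyP te].
have [x [y [xt yt xy]]] : exists x y, [/\ x \in t, y \in t & x != y].
  by apply/card_gt1P; rewrite (eqP t3).
have exy : e x y by have /'forall_implyP/(_ y yt)/implyP/(_ xy) := te x xt.
have xyE : [set x; y] \in edges by apply/imsetP; exists (x, y); rewrite ?inE.
by apply/'exists_andP; exists [set x; y]; rewrite inE xyE subUset !sub1set xt yt.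
Qed.

(* By transversal_edges, the default value of the arg min is admissible, so
   that the minimum is taken over a nonempty family. *)
Definition tau_triangle : nat :=
  #|[arg min_(S < edges | transversal S) #|S|]|.

Definition nu_triangle : nat := \max_(P : {set {set T}} | packing P) #|P|.

Lemma tau_triangleP :
  (exists2 S, transversal S & #|S| = tau_triangle) /\
  (forall S, transversal S -> tau_triangle <= #|S|).
Proof.
rewrite /tau_triangle; case: arg_minnP => [|S trS minS].
  exact: transversal_edges.
by split=> //; exists S.
Qed.

Lemma packing0 : packing set0.
Proof. by rewrite /packing sub0set; apply/forall_inP => t; rewrite inE. Qed.

Lemma nu_triangleP :
  (exists2 P, packing P & #|P| = nu_triangle) /\
  (forall P, packing P -> #|P| <= nu_triangle).
Proof.
split; last by move=> P pP; apply: (leq_bigmax_cond _ pP).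
have [|P pP maxP] := @eq_bigmax_cond _ packing (fun P => #|P|).
  by apply/card_gt0P; exists set0; apply: packing0.
by exists P; last exact: esym maxP.
Qed.

(* The partition is not required to have nonempty parts. *)
Definition tripartite (A B C : {set T}) : Prop :=
  [/\ A :|: B :|: C = [set: T],
      [/\ [disjoint A & B], [disjoint A & C] & [disjoint B & C]]
    & forall X, X \in [:: A; B; C] -> {in X &, forall x y, ~~ e x y}].

Definition complete_side (X Y : {set T}) : Prop :=
  {in X & Y, forall x y, e x y}.

Definition bilaterally_complete (A B C : {set T}) : Prop :=
  [\/ complete_side A B /\ complete_side A C,
      complete_side A B /\ complete_side B C
    | complete_side A C /\ complete_side B C].

End Triangles.

(* Main.v *)
Require Import Defs.
From mathcomp Require Import all_boot perm.
From mathcomp Require Import zify.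

Set Implicit Arguments.
Unset Strict Implicit.
Unset Printing Implicit Defensive.

(** The two complete sides share a part, say [C]; put [k = #|C|], and let [H]
    be the bipartite graph between [A] and [B].  A triangle is an edge of [H]
    together with an arbitrary vertex of [C], and the edge-disjointness of a
    family of triangles says that each vertex of [C] is used on a matching of
    [H] and that these [k] matchings are disjoint.  By König's edge-colouring
    theorem ([edge_colouring]) the edge sets that split into [k] matchings are
    those of maximum degree at most [k], so the packing number is the maximum
    size of an edge set of [H] with all degrees at most [k].

    Dually, let [X] and [Y] be sets of vertices of [A] and [B].  All edges
    from [X] and [Y] to [C], together with the edges of [H] that avoid [X] and
    [Y], meet every triangle.  There are [k * #|X| + k * #|Y| + e(H - X - Y)]
    of them, and the min-max theorem for degree-constrained edge sets in
    bipartite graphs ([max_degree_constrained]) gives an edge set of degree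
    at most [k] which is at least as large as the smallest value of this
    expression.  Hence the transversal number is at most the packing number;
    the converse is the general inequality [packing_leq_transversal]. *)

(** * Degree-constrained edge sets in bipartite graphs *)

Section DegreeConstrained.

Variables I J : finType.
Implicit Types (E F : {set I * J}) (X : {set I}) (Y : {set J}).

Definition ldeg E i := #|[set e in E | e.1 == i]|.
Definition rdeg E j := #|[set e in E | e.2 == j]|.

(** The capacity of the cut given by [X] and [Y] in the flow network that has
    an arc of capacity 1 for each edge, and vertex capacities [p] and [q]. *)
Definition cut (p : I -> nat) (q : J -> nat) E X Y :=
  \sum_i p i * (i \in X) + \sum_j q j * (j \in Y)
  + \sum_(e in E) ((e.1 \notin X) && (e.2 \notin Y)).

Lemma cutD1 p q E X Y u v : (u, v) \in E ->
  cut p q E X Y =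
  ((u \notin X) && (v \notin Y)) + cut p q (E :\ (u, v)) X Y.
Proof. by move=> uvE; rewrite /cut (big_setD1 (u, v) uvE) /= addnCA. Qed.

(** Cuts form a lattice once the order on one of the two sides is reversed;
    the inequality holds separately for each vertex and each edge. *)
Lemma cut_submodular p q E X Y X' Y' :
  cut p q E (X :&: X') (Y :|: Y') + cut p q E (X :|: X') (Y :&: Y')
  <= cut p q E X Y + cut p q E X' Y'.
Proof.
rewrite /cut addnACA [leqRHS]addnACA leq_add //.
  rewrite addnACA [leqRHS]addnACA -!big_split /= leq_add //; apply: leq_sum.
    move=> i _; rewrite !inE.
    by case: (i \in X); case: (i \in X'); rewrite /= ?muln0 ?muln1 ?addn0.
  move=> j _; rewrite !inE.
  by case: (j \in Y); case: (j \in Y'); rewrite /= ?muln0 ?muln1 ?addn0.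
rewrite -!big_split; apply: leq_sum => e _ /=; rewrite !inE.
by case: (e.1 \in X); case: (e.1 \in X'); case: (e.2 \in Y); case: (e.2 \in Y').
Qed.

Lemma sum_pred1_mul (K : finType) (D : {set K}) u :
  \sum_i (i == u) * (i \in D) = (u \in D).
Proof.
rewrite (bigD1 u) //= eqxx mul1n big1 ?addn0 // => i /negPf ->.
by rewrite mul0n.
Qed.

Lemma leq_sum_decr (K : finType) (p : K -> nat) (D : {set K}) u :
  \sum_i p i * (i \in D) <= \sum_i (p i - (i == u)) * (i \in D) + (u \in D).
Proof.
rewrite -(sum_pred1_mul D u) -big_split; apply: leq_sum => i _ /=.
by case: (i \in D); case: (i == u); rewrite ?muln0 ?muln1; lia.
Qed.

Lemma card_setU1_slice (P : pred (I * J)) F w : w \notin F ->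
  #|[set e in w |: F | P e]| = P w + #|[set e in F | P e]|.
Proof.
move=> wF; have [Pw | /negPf Pw] := boolP (P w); last first.
  apply: eq_card => e; rewrite !inE; case: eqP => [->|//].
  by rewrite Pw !andbF.
rewrite (_ : [set e in _ | _] = w |: [set e in F | P e]).
  by rewrite cardsU1 !inE (negPf wF).
by apply/setP => e; rewrite !inE; case: eqP => [->|].
Qed.

(** Induction on the number of edges.  If deleting the edge [uv] creates a cut
    of capacity less than [n], then [uv] is made part of the solution and the
    capacities of [u] and [v] drop by 1: uncrossing the cut that became too
    small with an arbitrary cut of the reduced instance shows that the latter
    has capacity at least [n - 1]. *)
Theorem max_degree_constrained E (p : I -> nat) (q : J -> nat) n :
    (forall X Y, n <= cut p q E X Y) ->
  exists F, [/\ F \subset E, forall i, ldeg F i <= p i,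
                forall j, rdeg F j <= q j & n <= #|F|].
Proof.
have [m] := ubnP #|E|; elim: m E p q n => // m IHm E p q n Em ncut.
have [E0 | [[u v] uvE]] := set_0Vmem E.
  exists set0; split=> [|i|j|]; rewrite ?sub0set // ?/ldeg ?/rdeg.
  - by rewrite (_ : [set _ in _ | _] = set0) ?cards0 //; apply/setP=> e; rewrite !inE.
  - by rewrite (_ : [set _ in _ | _] = set0) ?cards0 //; apply/setP=> e; rewrite !inE.
  have := ncut set0 set0; rewrite /cut E0 big_set0 cards0.
  by rewrite !big1 // => i _; rewrite inE muln0.
set E' := E :\ (u, v).
have E'm : #|E'| < m by move: Em; rewrite (cardsD1 (u, v)) uvE.
have sE'E : E' \subset E by apply: subsetDl.
have [/forallP cutE' | /forallPn/=[X /forallPn/=[Y]]] :=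
    boolP [forall X, forall Y, n <= cut p q E' X Y].
  have [|F [FE' dl dr nF]] := IHm E' p q n E'm; first by move=> X; apply/forallP.
  by exists F; split=> //; apply: subset_trans sE'E.
rewrite -ltnNge => XYn.
have /andP[uX vY] : (u \notin X) && (v \notin Y).
  apply/negPn/negP => /negPf uvXY.
  by have := ncut X Y; rewrite (cutD1 _ _ _ _ uvE) uvXY leqNgt XYn.
pose p' i := p i - (i == u); pose q' j := q j - (j == v).
(* Otherwise [u] could be added for free to [X], which then meets [uv]. *)
have pu : 0 < p u.
  have := ncut (u |: X) Y; rewrite (cutD1 _ _ _ _ uvE) !inE eqxx /= -/E' => nu.
  suff: cut p q E' (u |: X) Y <= p u + cut p q E' X Y by lia.
  rewrite /cut !addnA !leq_add //.
    rewrite (bigD1 u) //= [in leqRHS](bigD1 u) //= setU11 (negPf uX) muln1 muln0.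
    rewrite leq_add2l add0n; apply: leq_sum => i /negPf iu.
    by rewrite in_setU1 iu.
  apply: leq_sum => e _; rewrite in_setU1 negb_or.
  by case: (e.1 == u) => //=; case: (_ \notin _).
have qv : 0 < q v.
  have := ncut X (v |: Y); rewrite (cutD1 _ _ _ _ uvE) !inE eqxx /= andbF -/E' => nu.
  suff: cut p q E' X (v |: Y) <= q v + cut p q E' X Y by lia.
  rewrite /cut addnA leq_add //.
    rewrite addnCA leq_add2l.
    rewrite (bigD1 v) //= [in leqRHS](bigD1 v) //= setU11 (negPf vY) muln1 muln0.
    rewrite leq_add2l add0n; apply: leq_sum => i /negPf iu.
    by rewrite in_setU1 iu.
  apply: leq_sum => e _; rewrite in_setU1 negb_or.
  by case: (e.2 == v); rewrite //= andbF.
have [|F [FE' dl dr nF]] := IHm E' p' q' n.-1 E'm.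
  move=> X' Y'.
  (* [uv] avoids [X'] in the second uncrossed cut iff [u \notin X'], and [Y']
     in the first one iff [v \notin Y'], while the reduction of capacities
     costs 1 for [u \in X'] and 1 for [v \in Y']: the total is always 2. *)
  have p'p := leq_sum_decr p X' u; have q'q := leq_sum_decr q Y' v.
  have := ncut (X :&: X') (Y :|: Y'); have := ncut (X :|: X') (Y :&: Y').
  have := cut_submodular p q E' X Y X' Y'.
  rewrite !(cutD1 _ _ _ _ uvE) !inE (negPf uX) (negPf vY) /= -/E' andbT.
  have : cut p q E' X' Y' <= cut p' q' E' X' Y' + (u \in X') + (v \in Y').
    by rewrite /cut /p' /q'; lia.
  by case: (u \in X'); case: (v \in Y') => /=; lia.
have uvF : (u, v) \notin F.
  by apply/negP => /(subsetP FE'); rewrite !inE eqxx.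
exists ((u, v) |: F); split=> [|i|j|].
- by rewrite subUset sub1set uvE (subset_trans FE').
- rewrite /ldeg card_setU1_slice //=; have := dl i; rewrite /ldeg /p'.
  by have [->|_] := eqVneq i u; [move: #|_| pu => N; lia | rewrite subn0].
- rewrite /rdeg card_setU1_slice //=; have := dr j; rewrite /rdeg /q'.
  by have [->|_] := eqVneq j v; [move: #|_| qv => N; lia | rewrite subn0].
by rewrite cardsU1 uvF; lia.
Qed.

End DegreeConstrained.

(** * Edge colourings of bipartite graphs *)

Section EdgeColouring.

Variables I J K : finType.
Implicit Types (E : {set I * J}) (c : I * J -> option K).

(** Edges have a colour and non-edges have colour [None], which makes sense
    even when there are no colours. *)
Definition proper_colouring E c : Prop :=
  [/\ forall e, isSome (c e) = (e \in E),
      forall i j j' k, c (i, j) = Some k -> c (i, j') = Some k -> j = j'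
    & forall i i' j k, c (i, j) = Some k -> c (i', j) = Some k -> i = i'].

Lemma missing_colour c (D : {set I * J}) :
  #|D| < #|K| -> exists k, forall e, e \in D -> c e <> Some k.
Proof.
move=> DK; have [/forallP allK | /forallPn/=[k /exists_inPn kD]] :=
  boolP [forall k, exists e in D, c e == Some k].
  have : Some @: [set: K] \subset c @: D.
    apply/subsetP => _ /imsetP[k _ ->]; have /exists_inP[e eD /eqP <-] := allK k.
    exact: imset_f.
  move/subset_leq_card; rewrite card_imset; last by move=> x y [].
  by rewrite cardsT => /leq_trans/(_ (leq_imset_card c D)); rewrite leqNgt DK.
by exists k => e eD /eqP; rewrite (negPf (kD e eD)).
Qed.

Section Kempe.

Variables (E : {set I * J}) (c : I * J -> option K) (u : I) (a b : K).
Hypotheses (cP : proper_colouring E c) (ua : forall j, c (u, j) <> Some a).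

(** Two consecutive edges of a chain leaving [u]; as colour [a] is missing at
    [u], right vertices are entered along [b] and left vertices along [a]. *)
Definition kempe_step : rel I :=
  [rel i i' | [exists j, (c (i, j) == Some b) && (c (i', j) == Some a)]].

Definition kempe_swap (e : I * J) : option K :=
  if connect kempe_step u e.1 then omap (tperm a b) (c e) else c e.

(** The chain can only enter a left vertex along colour [a], so the edge of
    colour [a] at a vertex of the chain leads back to its predecessor. *)
Lemma kempe_pred i j : connect kempe_step u i -> c (i, j) = Some a ->
  exists2 i', connect kempe_step u i' & c (i', j) = Some b.
Proof.
have [_ cl _] := cP.
case/connectP => s; case/lastP: s => [_ -> /ua //|s i'].
rewrite rcons_path last_rcons => /andP[us /existsP[j' /andP[/eqP bj' /eqP aj']]] ->.
move=> /(cl _ _ _ _ aj') <-; exists (last u s) => //.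
by apply/connectP; exists s.
Qed.

Lemma omap_tperm_Some (o : option K) k :
  omap (tperm a b) o = Some k -> o = Some (tperm a b k).
Proof. by case: o => //= x [<-]; rewrite tpermK. Qed.

(** The colour classes [a] and [b] are exchanged on all edges at the left
    vertices of the chain.  A conflict at a right vertex [j] would involve
    edges of colours [a] and [b] at [j], exactly one of them on the chain; but
    either of these edges puts the other one on the chain. *)
Lemma kempe_swap_proper : proper_colouring E kempe_swap.
Proof.
have [cE cl cr] := cP; rewrite /kempe_swap; split=> [e | i j j' k | ] /=.
- by rewrite -cE; case: ifP => // _; case: (c e).
- by case: ifP => _; [move=> /omap_tperm_Some + /omap_tperm_Some | ]; apply: cl.
suff mixed i i' j k : connect kempe_step u i -> ~~ connect kempe_step u i' ->
    c (i, j) = Some (tperm a b k) -> c (i', j) <> Some k.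
  move=> i i' j k; case: ifP => ui; case: ifP => ui'.
  - by move=> /omap_tperm_Some + /omap_tperm_Some; apply: cr.
  - by move=> /omap_tperm_Some/(mixed _ _ _ _ ui (negbT ui')).
  - by move=> ci /omap_tperm_Some/(mixed _ _ _ _ ui' (negbT ui)).
  - exact: cr.
move=> ui /negP ui' cij ci'j.
case: tpermP cij => [ka | kb | _ _] cij.
- apply: ui'; apply: connect_trans ui (connect1 _).
  by apply/existsP; exists j; rewrite cij ci'j ka !eqxx.
- have [i2 ui2 ci2] := kempe_pred ui cij.
  by apply: ui'; rewrite kb in ci'j; rewrite -(cr _ _ _ _ ci2 ci'j).
by apply: ui'; rewrite -(cr _ _ _ _ cij ci'j).
Qed.

Lemma kempe_swap_left j : kempe_swap (u, j) <> Some b.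
Proof.
by rewrite /kempe_swap connect0 => /omap_tperm_Some; rewrite tpermR => /ua.
Qed.

(** The chain enters right vertices along colour [b], so it avoids [v]. *)
Lemma kempe_swap_right v : (forall i, c (i, v) <> Some b) ->
  forall i, kempe_swap (i, v) <> Some b.
Proof.
move=> vb i; rewrite /kempe_swap /=; case: ifP => [ui|_]; last exact: vb.
move/omap_tperm_Some; rewrite tpermR => /(kempe_pred ui)[i' _].
exact: vb.
Qed.

End Kempe.

(** König's edge-colouring theorem.  Given a proper colouring of all edges
    but [uv], some colour [a] is missing at [u] and some colour [b] at [v];
    after the exchange along a Kempe chain from [u], both miss [b]. *)
Theorem edge_colouring E :
    (forall i, ldeg E i <= #|K|) -> (forall j, rdeg E j <= #|K|) ->
  exists c, proper_colouring E c.
Proof.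
have [m] := ubnP #|E|; elim: m E => // m IHm E Em dl dr.
have [-> | [[u v] uvE]] := set_0Vmem E.
  by exists (fun=> None); split=> // e; rewrite inE.
set E' := E :\ (u, v).
have E'm : #|E'| < m by move: Em; rewrite (cardsD1 (u, v)) uvE.
have uvE' : (u, v) \notin E' by rewrite !inE eqxx.
have degE (P : pred (I * J)) :
    #|[set e in E | P e]| = P (u, v) + #|[set e in E' | P e]|.
  by rewrite -card_setU1_slice // setD1K.
have [||c0 c0P] := IHm E' E'm.
- by move=> i; apply: leq_trans (dl i); rewrite /ldeg degE leq_addl.
- by move=> j; apply: leq_trans (dr j); rewrite /rdeg degE leq_addl.
have [c0E _ _] := c0P.
have c0in e k : c0 e = Some k -> e \in E' by rewrite -c0E => ->.
have [|a ua] := @missing_colour c0 [set e in E' | e.1 == u].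
  by have := dl u; rewrite /ldeg degE /= eqxx.
have [|b vb] := @missing_colour c0 [set e in E' | e.2 == v].
  by have := dr v; rewrite /rdeg degE /= eqxx.
have {}ua j : c0 (u, j) <> Some a.
  by move=> H; apply: (ua _ _ H); rewrite inE (c0in _ _ H) /= eqxx.
have {}vb i : c0 (i, v) <> Some b.
  by move=> H; apply: (vb _ _ H); rewrite inE (c0in _ _ H) /= eqxx.
have [cE cl cr] := kempe_swap_proper b c0P ua.
have ub := kempe_swap_left (b := b) ua.
have {}vb := kempe_swap_right c0P ua vb.
set c := kempe_swap _ _ _ _ in cE cl cr ub vb.
exists (fun e => if e == (u, v) then Some b else c e); split.
- move=> e; rewrite -(setD1K uvE) in_setU1 -/E'.
  by case: eqP => //= _; apply: cE.
- move=> i j j' k; do 2![case: eqP].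
  + by move=> [_ ->] [_ ->].
  + by move=> _ [-> _] [<-] /ub.
  + by move=> [-> _] _ + [kb]; rewrite -kb => /ub.
  + by move=> _ _; apply: cl.
move=> i i' j k; do 2![case: eqP].
+ by move=> [-> _] [-> _].
+ by move=> _ [_ ->] [<-] /vb.
+ by move=> [_ ->] _ + [kb]; rewrite -kb => /vb.
by move=> _ _; apply: cr.
Qed.

End EdgeColouring.

(** * Triangles *)

Section Graph.

Variables (T : finType) (e : rel T).

(** Mapping each triangle of a packing to one of its edges in the transversal
    is injective, because the triangles are edge-disjoint. *)
Lemma packing_leq_transversal P S : packing e P -> Defs.transversal e S -> #|P| <= #|S|.
Proof.
move=> /andP[/subsetP Pt /forall_inP Pd] /andP[_ /forall_inP trS].
pose g t := odflt set0 [pick f in edges_of e t | f \in S].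
have gP t : t \in P -> g t \in edges_of e t /\ g t \in S.
  move=> tP; have /exists_inP[f ft fS] := trS t (Pt t tP).
  rewrite /g; case: pickP => [f' /andP[]//|/(_ f)].
  by rewrite ft fS.
rewrite -(card_in_imset (f := g) (D := P)).
  by apply: subset_leq_card; apply/subsetP => _ /imsetP[t /gP[_ ?] ->].
move=> t1 t2 t1P t2P gt; apply/eqP/negPn/negP => ne.
have /forall_inP/(_ t2 t2P)/implyP/(_ ne) := Pd t1 t1P.
move=> /pred0P/(_ (g t1)) /=.
by rewrite {2}gt (gP _ t1P).1 (gP _ t2P).1.
Qed.

Lemma mem_edges x y : e x y -> [set x; y] \in edges e.
Proof. by move=> exy; apply/imsetP; exists (x, y); rewrite ?inE. Qed.

Lemma card_independent_triangle t (X : {set T}) :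
  t \in triangles e -> {in X &, forall x y, ~~ e x y} -> #|t :&: X| <= 1.
Proof.
rewrite inE => /andP[_ /forall_inP tr] Xi; rewrite leqNgt; apply/card_gt1P => -[x [y []]].
rewrite !inE => /andP[xt xX] /andP[yt yX] xy.
have /forall_inP/(_ y yt)/implyP/(_ xy) := tr x xt.
by apply/negP; apply: Xi.
Qed.

Lemma tripartite_rot A B C : tripartite e A B C -> tripartite e B C A.
Proof.
case=> cov [AB AC BC] ind; split.
- by rewrite setUC setUA.
- by split; rewrite // disjoint_sym.
by move=> X XBC; apply: ind; move: XBC; rewrite !inE => /or3P[]->; rewrite ?orbT.
Qed.

Section Apex.

Variables A B C : {set T}.
Hypotheses (He : simple_graph e) (Htri : tripartite e A B C).
Hypotheses (AC : complete_side e A C) (BC : complete_side e B C).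

Let apex := {z : T | z \in C}.

Definition base : {set T * T} :=
  [set p | [&& p.1 \in A, p.2 \in B & e p.1 p.2]].

Definition trip (a b z : T) : {set T} := [set a; b; z].

Lemma in_parts x : [|| x \in A, x \in B | x \in C].
Proof.
have [cov _ _] := Htri.
by have := in_setT x; rewrite -cov !inE -orbA.
Qed.

Lemma parts_disjoint x : [/\ x \in A -> x \in B = false, x \in A -> x \in C = false
                  & x \in B -> x \in C = false].
Proof.
by have [_ [dAB dAC dBC] _] := Htri; split=> xX; apply: (disjointFr _ xX).
Qed.

(** As the parts are disjoint, a common vertex of two triangles has the same
    role in both. *)
Lemma trip_shared x a b z a' b' z' :
    a \in A -> b \in B -> z \in C -> a' \in A -> b' \in B -> z' \in C ->
    x \in trip a b z -> x \in trip a' b' z' ->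
  [\/ x = a /\ a = a', x = b /\ b = b' | x = z /\ z = z'].
Proof.
move=> aA bB zC a'A b'B z'C; rewrite !inE -!orbA.
have [AnB AnC _] := parts_disjoint a; have [a'nB a'nC _] := parts_disjoint a'.
have [_ _ BnC] := parts_disjoint b; have [_ _ b'nC] := parts_disjoint b'.
case/or3P=> /eqP -> /or3P[] /eqP E;
  first [by constructor 1 | by constructor 2 | by constructor 3 | exfalso].
- by move: (AnB aA); rewrite E b'B.
- by move: (AnC aA); rewrite E z'C.
- by move: (a'nB a'A); rewrite -E bB.
- by move: (BnC bB); rewrite E z'C.
- by move: (a'nC a'A); rewrite -E zC.
by move: (b'nC b'B); rewrite -E zC.
Qed.

Lemma trip_triangle a b z : (a, b) \in base -> z \in C -> trip a b z \in triangles e.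
Proof.
have [es ei] := He.
rewrite inE /= => /and3P[aA bB eab] zC.
have eaz := AC aA zC; have ebz := BC bB zC.
have ne x y : e x y -> x != y by apply: contraTneq => ->; rewrite ei.
rewrite inE; apply/andP; split.
  by rewrite /trip -setUA cardsU1 !inE negb_or !ne //= cardsU1 inE ne //= cards1.
apply/forall_inP => x xt; apply/forall_inP => y yt; apply/implyP.
move: xt yt; rewrite !inE -!orbA.
by case/or3P=> /eqP-> /or3P[] /eqP->; rewrite ?eqxx // es.
Qed.

(** A matching of [base] for each vertex of [C], given as the colour classes
    of a colouring, becomes a packing: triangles that share an edge of the
    base have the same colour, and those that share an edge to [C] are equal
    because the colouring is proper. *)
Lemma packing_of_colouring (F : {set T * T}) (c : T * T -> option apex) :
  F \subset base -> proper_colouring F c -> #|F| <= nu_triangle e.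
Proof.
have [es ei] := He; have [_ nuP] := nu_triangleP e.
move=> /subsetP Fb [cF cl cr].
pose tri p := oapp (fun z : apex => trip p.1 p.2 (val z)) set0 (c p).
have triP p : p \in F -> exists z : apex, [/\ c p = Some z, tri p = trip p.1 p.2 (val z),
    p.1 \in A & p.2 \in B].
  move=> pF; have := Fb p pF; rewrite inE => /and3P[pA pB _].
  move: pF; rewrite -cF /tri; case: (c p) => // z _.
  by exists z.
have shared p p' x y : p \in F -> p' \in F -> x != y ->
    x \in tri p -> x \in tri p' -> y \in tri p -> y \in tri p' -> p = p'.
  move=> /triP[z [cp -> pA pB]] /triP[z' [cp' -> pA' pB']] xy xp xp' yp yp'.
  case: p p' cp cp' pA pB pA' pB' xp xp' yp yp' => [a b] [a' b'] /= cp cp'.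
  move=> aA bB a'A b'B xp xp' yp yp'.
  have := trip_shared aA bB (valP z) a'A b'B (valP z') yp yp'.
  have := trip_shared aA bB (valP z) a'A b'B (valP z') xp xp'.
  move=> [[xE E1]|[xE E1]|[xE /val_inj E1]] [[yE E2]|[yE E2]|[yE /val_inj E2]];
    move: xy; rewrite xE yE ?eqxx // => _; rewrite E1 E2 // in cp *.
  - by rewrite (cl _ _ _ _ cp cp').
  - by rewrite (cr _ _ _ _ cp cp').
  - by rewrite (cl _ _ _ _ cp cp').
  by rewrite (cr _ _ _ _ cp cp').
have tri_edge p : p \in F -> [/\ p.1 \in tri p, p.2 \in tri p & p.1 != p.2].
  move=> pF; have [z [_ -> pA pB]] := triP p pF.
  rewrite !inE !eqxx ?orbT; split=> //; apply: contraTneq pA => ->.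
  by have [AB _ _] := parts_disjoint p.2; apply/negP => /AB; rewrite pB.
rewrite -(card_in_imset (f := tri) (D := F)).
  apply: nuP; apply/andP; split.
    apply/subsetP => _ /imsetP[p pF ->]; have [z [_ -> _ _]] := triP p pF.
    by apply: trip_triangle (valP z); rewrite -surjective_pairing; apply: Fb.
  apply/forall_inP => _ /imsetP[p pF ->]; apply/forall_inP => _ /imsetP[p' pF' ->].
  apply/implyP; apply: contraR => /pred0Pn[f /= /andP[]].
  rewrite !inE => /andP[/imsetP[[x y]]]; rewrite inE /= => exy ->.
  rewrite subUset !sub1set => /andP[xp yp] /andP[_].
  rewrite subUset !sub1set => /andP[xp' yp'].
  have xy : x != y by apply: contraTneq exy => ->; rewrite ei.
  by rewrite (shared p p' x y).
move=> p p' pF pF' E; have [p1 p2 p12] := tri_edge p pF.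
by apply: (shared p p' p.1 p.2); rewrite // -E.
Qed.

(** The edge set behind a cut.  As [X] and [Y] need not lie in [A] and [B], the
    pairs that are not edges are discarded. *)
Definition cut_edges (X Y : {set T}) : {set {set T}} :=
  edges e :&:
    ([set [set p.1; p.2] | p in setX X C] :|: [set [set p.1; p.2] | p in setX Y C]
     :|: [set [set p.1; p.2] | p in [set p in base | (p.1 \notin X) && (p.2 \notin Y)]]).

Lemma card_cut_edges X Y :
  #|cut_edges X Y| <= cut (fun=> #|C|) (fun=> #|C|) base X Y.
Proof.
apply: leq_trans (subset_leq_card (subsetIr _ _)) _.
have sumX (Z : {set T}) : \sum_i #|C| * (i \in Z) = #|setX Z C|.
  by rewrite -big_distrr /= cardsX [RHS]mulnC -(sum1_card (mem Z)) [in RHS]big_mkcond.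
have avoid : #|[set p in base | (p.1 \notin X) && (p.2 \notin Y)]|
    = \sum_(p in base) ((p.1 \notin X) && (p.2 \notin Y)).
  rewrite -sum1_card; under eq_bigl do rewrite inE.
  by rewrite big_mkcondr.
rewrite /cut !sumX -avoid.
apply: leq_trans (leq_card_setU _ _) (leq_add _ (leq_imset_card _ _)).
by apply: leq_trans (leq_card_setU _ _) (leq_add _ _); apply: leq_imset_card.
Qed.

(** The parts are independent, so each contains at most one, and hence exactly
    one, of the three vertices. *)
Lemma triangle_parts t : t \in triangles e ->
  exists a b z, [/\ (a, b) \in base, z \in C & [set a; b; z] \subset t].
Proof.
move=> tt; have [_ _ ind] := Htri.
have tA := card_independent_triangle tt (ind A ltac:(by rewrite !inE eqxx)).
have tB := card_independent_triangle tt (ind B ltac:(by rewrite !inE eqxx ?orbT)).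
have tC := card_independent_triangle tt (ind C ltac:(by rewrite !inE eqxx ?orbT)).
have := tt; rewrite inE => /andP[/eqP t3 /forall_inP tr].
have : #|t| <= #|t :&: A| + (#|t :&: B| + #|t :&: C|).
  apply: leq_trans (leq_trans (leq_card_setU _ _) (leq_add (leqnn _) (leq_card_setU _ _))).
  apply: subset_leq_card; apply/subsetP => x xt.
  by rewrite !inE xt /= in_parts.
rewrite t3 => t3'.
have /card_gt0P[a] : 0 < #|t :&: A| by lia.
have /card_gt0P[b] : 0 < #|t :&: B| by lia.
have /card_gt0P[z] : 0 < #|t :&: C| by lia.
rewrite !inE => /andP[zt zC] /andP[bt bB] /andP[at_ aA].
exists a, b, z; split=> //; last by rewrite !subUset !sub1set at_ bt zt.
rewrite inE /= aA bB /=.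
have /forall_inP/(_ b bt)/implyP := tr a at_; apply.
apply: contraTneq aA => ->.
by have [AB _ _] := parts_disjoint b; apply/negP => /AB; rewrite bB.
Qed.

Lemma cut_edges_transversal X Y : Defs.transversal e (cut_edges X Y).
Proof.
rewrite /Defs.transversal subsetIl; apply/forall_inP => t /triangle_parts[a [b [z [ab zC]]]].
have := ab; rewrite inE /= => /and3P[aA bB eab].
rewrite !subUset !sub1set -andbA => /and3P[ta tb tz].
have use x y : e x y -> x \in t -> y \in t -> [set x; y] \in cut_edges X Y ->
    [exists f in edges_of e t, f \in cut_edges X Y].
  move=> exy xt yt H; apply/exists_inP; exists [set x; y] => //.
  by rewrite inE mem_edges //= subUset !sub1set xt.
have [aX | aX] := boolP (a \in X).
  have eaz := AC aA zC; apply: (use a z) => //.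
  rewrite inE mem_edges //= !inE; apply/orP; left; apply/orP; left.
  by apply/imsetP; exists (a, z); rewrite // inE /= aX.
have [bY | bY] := boolP (b \in Y).
  have ebz := BC bB zC; apply: (use b z) => //.
  rewrite inE mem_edges //= !inE; apply/orP; left; apply/orP; right.
  by apply/imsetP; exists (b, z); rewrite // inE /= bY.
apply: (use a b) => //; rewrite inE mem_edges //= !inE; apply/orP; right.
by apply/imsetP; exists (a, b); rewrite // inE ab /= aX.
Qed.

(** Every cut of [base] is at least as large as a minimum transversal, so the
    min-max theorem gives an edge set of that size, which is then coloured. *)
Lemma tau_eq_nu_apex : tau_triangle e = nu_triangle e.
Proof.
have [[S trS cardS] tau_le] := tau_triangleP e; have [[P pP cardP] _] := nu_triangleP e.
rewrite -cardS -cardP; apply/eqP.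
rewrite eqn_leq [X in _ && X]packing_leq_transversal // andbT.
have cutS X Y : #|S| <= cut (fun=> #|C|) (fun=> #|C|) base X Y.
  rewrite cardS; apply: leq_trans (card_cut_edges X Y).
  exact/tau_le/cut_edges_transversal.
have [F [Fb dl dr SF]] := max_degree_constrained cutS.
have apexC : #|{: apex}| = #|C| by rewrite card_sig; apply: eq_card.
have [|| c cP] := @edge_colouring T T apex F.
- by move=> i; rewrite apexC.
- by move=> j; rewrite apexC.
by rewrite cardP (leq_trans SF) // (packing_of_colouring Fb cP).
Qed.


End Apex.

End Graph.

Lemma complete_side_sym (T : finType) (e : rel T) (X Y : {set T}) :
  simple_graph e -> complete_side e X Y -> complete_side e Y X.
Proof. by move=> [es _] XY y x yY xX; rewrite es; apply: XY. Qed.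

Theorem theorem1 (T : finType) (e : rel T) (A B C : {set T})
  (He : simple_graph e) (Htri : tripartite e A B C)
  (Hbc : bilaterally_complete e A B C) :
  tau_triangle e = nu_triangle e.
Proof.
have Htri' := tripartite_rot Htri; have Htri'' := tripartite_rot Htri'.
case: Hbc => -[H1 H2].
- exact: tau_eq_nu_apex He Htri' (complete_side_sym He H1) (complete_side_sym He H2).
- exact: tau_eq_nu_apex He Htri'' (complete_side_sym He H2) H1.
- exact: tau_eq_nu_apex He Htri H1 H2.
Qed.
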